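(* Let $\Phi(E)=\sum_{i=0}^{n}a_iE^i$ with constant coefficients satisfying $a_0a_n\neq 0$, and suppose that $\Phi(E)$ can be factored into linear factors as $\Phi(E)=\prod_{i=1}^{n}(E-\lambda_iI)$. Let $f:\mathbb{R}\to\mathbb{R}$ be a given function. Then a particular solution $y_p$ of the difference equation $\Phi(E)y(t)=f(t)$, that is, of $\sum_{i=0}^{n}a_iy(t+i)=f(t)$, is given by $$y_p(t)=\sum_{s_n=1}^{\lfloor t\rfloor}\ \sum_{s_{n-1}=1}^{\lfloor t-s_n\rfloor}\cdots\sum_{s_1=1}^{\lfloor t-s_2-s_3-\cdots-s_n\rfloor}\left(\prod_{j=1}^{n}\lambda_j^{s_j-1}\right)f\left(t-\sum_{j=1}^{n}s_j\right).$$
   Context: $E$ is the shift operator, $(Ey)(t)=y(t+1)$, and $I=E^0$ is the identity operator. $\lfloor\cdot\rfloor$ is the usual floor function. In the nested sum, the upper limit for $s_k$ is $\lfloor t-s_{k+1}-\cdots-s_n\rfloor$ (for $k=n$ it is $\lfloor t\rfloor$). A sum whose upper limit is smaller than its lower limit equals $0$.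
   Formalization: The equation is asserted only for t ≥ 0: for t < 0 and n ≥ 1 all sums defining y_p(t+i) are empty, so the left side is 0 and the equation fails wherever f(t) ≠ 0 (e.g. n = 1, f = 1, t = −1). *)

(* Defs.v *)
From HB Require Import structures.
From mathcomp Require Import all_boot all_order all_algebra.
From mathcomp Require Import complex.
From mathcomp Require Import reals.

Set Implicit Arguments.
Unset Strict Implicit.
Unset Printing Implicit Defensive.

Import Order.TTheory GRing.Theory Num.Theory.
Local Open Scope ring_scope.

Definition operator (R : realType) := (R -> R[i]) -> (R -> R[i]).

Definition shift (R : realType) : operator R := fun y t => y (t + 1).

(* Coefficients and roots may be complex (real ones embed); hence operators act
   on complex-valued functions of the real variable t. *)
Definition Phi (R : realType) (n : nat) (a : 'I_n.+1 -> R[i]) : operator R :=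
  fun y t => \sum_(i < n.+1) a i * iter i (@shift R) y t.

Definition linear_factor (R : realType) (lam : R[i]) : operator R :=
  fun y t => shift y t - lam * y t.

(* Product of operators is composition; the factors commute, so the order in
   which they are composed does not matter. *)
Definition factored (R : realType) (n : nat) (lam : 'I_n -> R[i]) : operator R :=
  \big[(fun A B : operator R => A \o B)/(id : operator R)]_(i < n)
    linear_factor (lam i).

(* The sum of F s for s from 1 to m, equal to 0 when m < 1. *)
Definition sum_from1 (R : realType) (m : int) (F : nat -> R[i]) : R[i] :=
  match m with
  | Posz k => \sum_(1 <= s < k.+1) F s
  | Negz _ => 0
  end.

(* [nested_sum k t [:: s_(k+1); ...; s_n] G] is the sum over s_k, ..., s_1
   (outermost to innermost) of G [:: s_1; ...; s_n], where s_k runs from 1 to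
   floor (t - s_(k+1) - ... - s_n). *)
Fixpoint nested_sum (R : realType) (k : nat) (t : R) (ss : seq nat)
    (G : seq nat -> R[i]) : R[i] :=
  match k with
  | 0 => G ss
  | k'.+1 => sum_from1 (Num.floor (t - \sum_(s <- ss) s%:R))
               (fun s => nested_sum k' t (s :: ss) G)
  end.

(* The index j : 'I_n starts at 0, so [lam j] is the root numbered j + 1 and
   [nth 0 s j] is the summation index s_(j+1).
   For n >= 1 this function vanishes for t < n (the summation range is empty),
   so for t < 0 it satisfies Phi(E) y (t) = f t only where f vanishes; the difference equation
   is meant on t >= 0. *)
Definition yp (R : realType) (n : nat) (lam : 'I_n -> R[i]) (f : R -> R)
    (t : R) : R[i] :=
  nested_sum n t [::] (fun s : seq nat =>
    (\prod_(j < n) lam j ^+ (nth 0%N s j - 1)) *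
    (f (t - \sum_(j < n) (nth 0%N s j)%:R))%:C%C).

(* Main.v *)
(* Summing over s_n first, the nested sum is a Duhamel-type convolution:
   y_n(t) = sum_(1 <= s <= floor t) lambda_n^(s-1) y_(n-1)(t - s) with y_0 = f.
   Shifting t by 1 adds one term to the sum, so (E - lambda_n) y_n = y_(n-1) on
   t >= 0. As the half-line t >= 0 is stable under the shift, the linear factors
   can be peeled off one after the other. *)
Require Import Defs.
From HB Require Import structures.
From mathcomp Require Import all_boot all_order all_algebra.
From mathcomp Require Import complex.
From mathcomp Require Import reals.

Import Order.TTheory GRing.Theory Num.Theory.
Local Open Scope ring_scope.

(** A named form of the composition in [factored], convertible to it, to which a monoid structure
    can be attached; [big_ord_recr] then splits off the last factor. *)
Definition compose_op (R : realType) (A B : operator R) : operator R := A \o B.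

HB.instance Definition _ (R : realType) :=
  Monoid.isLaw.Build (operator R) id (@compose_op R)
    (fun A B C => erefl) (fun A => erefl) (fun A => erefl).

Lemma eq_sum_from1 {R : realType} (m : int) (F G : nat -> R[i]) :
  F =1 G -> sum_from1 m F = sum_from1 m G.
Proof. by move=> FG; case: m => //= k; apply: eq_bigr. Qed.

Lemma mulr_sum_from1 {R : realType} (c : R[i]) (m : int) (F : nat -> R[i]) :
  sum_from1 m (fun s => c * F s) = c * sum_from1 m F.
Proof. by case: m => [k|k] /=; rewrite ?mulr_sumr ?mulr0. Qed.

Definition discrete_duhamel {R : realType} (mu : R[i]) (g : R -> R[i]) (t : R) :
    R[i] :=
  sum_from1 (Num.floor t) (fun s => mu ^+ (s - 1) * g (t - s%:R)).

Lemma linear_factor_duhamel {R : realType} (mu : R[i]) (g : R -> R[i]) (t : R) :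
  0 <= t -> linear_factor mu (discrete_duhamel mu g) t = g t.
Proof.
move=> t0; rewrite /linear_factor /shift /discrete_duhamel.
have -> : Num.floor (t + 1) = Num.floor t + 1 by rewrite floorDrz ?floor1.
(* For a negative floor both sums would be empty and the term [g t] would be lost. *)
have : 0 <= Num.floor t by rewrite floor_ge0.
case: (Num.floor t) => // k _ /=; rewrite addn1.
(* The term [s = 1] of the shifted sum is [g t]; its term [s + 1] cancels [mu] times the term [s] of
   the original sum. The bound [1 <= s] keeps the truncated [s - 1] honest. *)
rewrite big_nat_recl //= expr0 mul1r addrK mulr_sumr -addrA -sumrB big1_seq ?addr0 //.
move=> s /andP[_]; rewrite mem_index_iota => /andP[s1 _].
rewrite mulrA -exprS !subn1 /= prednK // -natr1.
by rewrite opprD addrACA subrr addr0 subrr.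
Qed.

Fixpoint iterated_duhamel {R : realType} (mu : nat -> R[i]) (g : R -> R[i])
    (k : nat) : R -> R[i] :=
  if k is k'.+1 then discrete_duhamel (mu k') (iterated_duhamel mu g k')
  else g.

Definition linear_factors {R : realType} (mu : nat -> R[i]) (k : nat) :
    operator R :=
  \big[@compose_op R/id]_(i < k) linear_factor (mu i).

(** The last factor is innermost in the composition, so it acts first and meets the outermost
    Duhamel sum. *)
Lemma linear_factorsS {R : realType} (mu : nat -> R[i]) (k : nat) y :
  linear_factors mu k.+1 y = linear_factors mu k (linear_factor (mu k) y).
Proof. by rewrite /linear_factors big_ord_recr. Qed.

(** [linear_factor_duhamel] holds only for [0 <= t], hence is no equality of functions; it can still
    be used under the remaining factors, which evaluate only at [t] and later points. *)
Lemma eq_linear_factors {R : realType} (mu : nat -> R[i]) (k : nat)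
    (y z : R -> R[i]) :
  (forall t, 0 <= t -> y t = z t) ->
  forall t, 0 <= t -> linear_factors mu k y t = linear_factors mu k z t.
Proof.
elim: k y z => [|k IH] y z yz t t0.
  by rewrite /linear_factors !big_ord0 yz.
rewrite !linear_factorsS; apply: IH t0 => u u0.
by rewrite /linear_factor /shift !yz // addr_ge0.
Qed.

Lemma linear_factors_iterated_duhamel {R : realType} (mu : nat -> R[i])
    (g : R -> R[i]) (k : nat) (t : R) :
  0 <= t -> linear_factors mu k (iterated_duhamel mu g k) t = g t.
Proof.
move=> t0; elim: k => [|k <-]; first by rewrite /linear_factors big_ord0.
rewrite linear_factorsS; apply: eq_linear_factors t0 => u u0.
exact: linear_factor_duhamel.
Qed.

(* [ss] lists the summation indices s_(k+1), ..., s_n already fixed. *)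
Lemma nested_sum_iterated_duhamel {R : realType} (mu : nat -> R[i])
    (g : R -> R[i]) (t : R) (k : nat) (ss : seq nat) :
  nested_sum k t ss (fun s =>
    (\prod_(j < size s) mu j ^+ (nth 0%N s j - 1)) *
    g (t - \sum_(j < size s) (nth 0%N s j)%:R)) =
  (\prod_(j < size ss) mu (k + j)%N ^+ (nth 0%N ss j - 1)) *
    iterated_duhamel mu g k (t - \sum_(s <- ss) s%:R).
Proof.
elim: k ss => [|k IH] ss /=; first by rewrite (big_nth 0%N) big_mkord.
rewrite /discrete_duhamel -mulr_sum_from1; apply: eq_sum_from1 => s.
(* The new head [s] carries the weight [mu k ^+ (s - 1)] of the outer Duhamel sum; the older entries
   move up one place while [k.+1] drops to [k], so each keeps its root. *)
rewrite IH /= big_ord_recl big_cons /= addn0 [in RHS]mulrA.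
congr (_ * iterated_duhamel mu g k _).
  rewrite mulrC; congr (_ * _); apply: eq_bigr => j _.
  by rewrite /bump /= addnS addSn.
by rewrite opprD addrCA addrC -addrA addrC -addrA.
Qed.

(** Each of the [k] sums prepends one index, so [G] only sees lists of this length. This lets
    [size s] be replaced by [n] in the summand. *)
Lemma eq_nested_sum {R : realType} (k : nat) (t : R) (ss : seq nat)
    (G H : seq nat -> R[i]) :
  (forall s, size s = (k + size ss)%N -> G s = H s) ->
  nested_sum k t ss G = nested_sum k t ss H.
Proof.
elim: k ss => [|k IH] ss GH /=; first exact: GH.
apply: eq_sum_from1 => s; apply: IH => s' Hs'.
by apply: GH; rewrite Hs' /= addnS.
Qed.

Lemma yp_iterated_duhamel {R : realType} (n : nat) (mu : nat -> R[i])
    (f : R -> R) (t : R) :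
  yp (fun j : 'I_n => mu j) f t =
  iterated_duhamel mu (fun u => (f u)%:C%C) n t.
Proof.
have := nested_sum_iterated_duhamel mu (fun u => (f u)%:C%C) t n [::].
rewrite big_ord0 big_nil mul1r subr0 => <-.
by apply: eq_nested_sum => s; rewrite addn0 => ->.
Qed.

Theorem theorem2p10 (R : realType) (n : nat) (a : 'I_n.+1 -> R[i])
    (lam : 'I_n -> R[i]) (f : R -> R)
    (ha : a ord0 * a ord_max != 0)
    (hfactor : forall (y : R -> R[i]) (t : R), Phi a y t = factored lam y t) :
  forall t : R, 0 <= t -> Phi a (yp lam f) t = (f t)%:C%C.
Proof.
move=> t t0; rewrite hfactor.
(* Indexing the roots by [nat] keeps their type fixed during induction; the default 0 is taken only
   from [n] on. *)
pose mu k := if insub k is Some j then lam j else 0.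
have muE (j : 'I_n) : mu j = lam j by rewrite /mu valK.
have -> : factored lam = linear_factors mu n.
  by apply: eq_bigr => j _; rewrite muE.
rewrite -(linear_factors_iterated_duhamel mu (fun u => (f u)%:C%C) n t t0).
apply: eq_linear_factors t0 => u _; rewrite -yp_iterated_duhamel.
apply: eq_nested_sum => s _; congr (_ * _).
by apply: eq_bigr => j _; rewrite muE.
Qed.
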